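(* Let $A(\Gamma)$ be an ear RAAG with $\Gamma\neq C_4$, where $C_4$ is the cycle on $4$ vertices. Let $x\in A(\Gamma)$ be a nontrivial element with non-abelian centralizer such that $x$ generates the center of its centralizer. Then, up to conjugacy and inversion, $x$ arises from a degree $2$ vertex in $\Gamma$; that is, there is a vertex $v$ of degree $2$ in $\Gamma$ such that $x$ is conjugate in $A(\Gamma)$ to $v$ or to $v^{-1}$.
   Context: All graphs are finite, undirected and simple. The right-angled Artin group (RAAG) with underlying graph $\Gamma$ is $A(\Gamma)=\langle v\in V(\Gamma)\mid [v,w]=1\text{ whenever }\{v,w\}\in E(\Gamma)\rangle$; vertices are identified with the corresponding generators. An ear is a graph that is a path or a cycle, with more than one vertex; an ear RAAG is a RAAG whose underlying graph is an ear. *)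

(* Defs.v *)
From HB Require Import structures.
From mathcomp Require Import all_boot generic_quotient.
From mathcomp Require Import boolp classical_sets.

Set Implicit Arguments.
Unset Strict Implicit.
Unset Printing Implicit Defensive.

Local Open Scope group_scope.
Local Open Scope quotient_scope.
Local Open Scope classical_set_scope.

Record sgraph := SGraph {
  vertex :> finType;
  adj : rel vertex;
  adj_sym : symmetric adj;
  adj_irr : irreflexive adj }.

Definition degree (G : sgraph) (v : G) : nat := #|[pred w | adj v w]|.

Definition graph_iso (G H : sgraph) : Prop :=
  exists2 f : G -> H, bijective f & {mono f : v w / adj v w}.

Section StandardGraphs.
Variable n : nat.

Definition path_adj : rel 'I_n :=
  fun i j => (i.+1 == j :> nat) || (j.+1 == i :> nat).

Lemma path_adj_sym : symmetric path_adj.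
Proof. by move=> i j; rewrite /path_adj orbC. Qed.

Lemma path_adj_irr : irreflexive path_adj.
Proof. by move=> i; rewrite /path_adj orbb eqn_leq ltnn. Qed.

Definition path_graph : sgraph := SGraph path_adj_sym path_adj_irr.

(* [ordS] is the cyclic successor on ['I_n].  The conjunct [i != j] only
   matters for n = 1; this is the n-cycle as soon as 3 <= n. *)
Definition cycle_adj : rel 'I_n :=
  fun i j => (i != j) && ((ordS i == j) || (ordS j == i)).

Lemma cycle_adj_sym : symmetric cycle_adj.
Proof. by move=> i j; rewrite /cycle_adj orbC eq_sym. Qed.

Lemma cycle_adj_irr : irreflexive cycle_adj.
Proof. by move=> i; rewrite /cycle_adj eqxx. Qed.

Definition cycle_graph : sgraph := SGraph cycle_adj_sym cycle_adj_irr.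

End StandardGraphs.

Definition is_path (G : sgraph) : Prop := exists n, graph_iso G (path_graph n).

Definition is_cycle (G : sgraph) : Prop :=
  exists2 n, 3 <= n & graph_iso G (cycle_graph n).

Definition is_ear (G : sgraph) : Prop := 1 < #|G| /\ (is_path G \/ is_cycle G).

Section RAAG.
Variable G : sgraph.

(* Group words on the vertices: [(v, false)] stands for v and [(v, true)]
   for its inverse. *)
Definition word : Type := seq (G * bool).
HB.instance Definition _ := Choice.on word.

(* The congruence on words presenting
   < v in V(G) | vw = wv whenever {v, w} is an edge >. *)
Inductive raag_cong : word -> word -> Prop :=
| raag_refl u : raag_cong u u
| raag_sym u v : raag_cong u v -> raag_cong v u
| raag_trans v u w : raag_cong u v -> raag_cong v w -> raag_cong u w
| raag_cat u u' v v' :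
    raag_cong u u' -> raag_cong v v' -> raag_cong (u ++ v) (u' ++ v')
| raag_cancel (a : G) (b : bool) : raag_cong [:: (a, b); (a, ~~ b)] [::]
| raag_comm (a b : G) : adj a b ->
    raag_cong [:: (a, false); (b, false)] [:: (b, false); (a, false)].

Definition raag_rel : rel word := fun u v => `[< raag_cong u v >].

Lemma raag_rel_refl : reflexive raag_rel.
Proof. by move=> u; apply/asboolP/raag_refl. Qed.

Lemma raag_rel_sym : symmetric raag_rel.
Proof. by move=> u v; apply/asboolP/asboolP => /raag_sym. Qed.

Lemma raag_rel_trans : transitive raag_rel.
Proof.
by move=> v u w /asboolP uv /asboolP vw; apply/asboolP/(raag_trans uv vw).
Qed.

Canonical raag_equiv_rel :=
  EquivRel raag_rel raag_rel_refl raag_rel_sym raag_rel_trans.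

Definition raag : Type := {eq_quot raag_rel}.
HB.instance Definition _ : EqQuotient word raag_rel raag := EqQuotient.on raag.
HB.instance Definition _ := Choice.on raag.

Lemma raag_piP (u v : word) : (\pi_raag u = \pi_raag v) <-> raag_cong u v.
Proof.
by split=> [/eqmodP /asboolP | uv] //; apply/eqmodP/asboolP.
Qed.

Lemma raag_reprP (u : word) : raag_cong (repr (\pi_raag u)) u.
Proof. by apply/raag_piP; rewrite reprK. Qed.

Definition word_inv (u : word) : word := rev [seq (x.1, ~~ x.2) | x <- u].

Lemma word_inv_cat u v : word_inv (u ++ v) = word_inv v ++ word_inv u.
Proof. by rewrite /word_inv map_cat rev_cat. Qed.

Lemma word_invK : involutive word_inv.
Proof.
move=> u; rewrite /word_inv map_rev revK -map_comp -[RHS]map_id.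
by apply: eq_map => -[a b] /=; rewrite negbK.
Qed.

Lemma word_mulV u : raag_cong (u ++ word_inv u) [::].
Proof.
elim: u => [|[a b] u IHu]; first exact: raag_refl.
rewrite -cat1s word_inv_cat -catA [u ++ _]catA.
apply: (raag_trans (v := [:: (a, b)] ++ [::] ++ word_inv [:: (a, b)])).
  apply: raag_cat; first exact: raag_refl.
  by apply: raag_cat => //; apply: raag_refl.
exact: raag_cancel.
Qed.

Lemma word_inv_cong u v : raag_cong u v -> raag_cong (word_inv u) (word_inv v).
Proof.
move=> uv; have refl := raag_refl.
(* u^-1 ~ u^-1 (v v^-1) ~ u^-1 (u v^-1) ~ v^-1 *)
apply: (raag_trans (v := word_inv u ++ v ++ word_inv v)).
  rewrite -[X in raag_cong X _]cats0; apply: raag_cat => //.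
  exact/raag_sym/word_mulV.
apply: (raag_trans (v := word_inv u ++ u ++ word_inv v)).
  by apply: raag_cat => //; apply: raag_cat => //; apply: raag_sym.
rewrite catA -[X in raag_cong _ X]cat0s; apply: raag_cat => //.
by rewrite -{2}[u]word_invK; apply: word_mulV.
Qed.

Definition raag_one : raag := \pi_raag [::].
Definition raag_mul (x y : raag) : raag := \pi_raag (repr x ++ repr y).
Definition raag_inv (x : raag) : raag := \pi_raag (word_inv (repr x)).

Lemma raag_mul_pi u v :
  raag_mul (\pi_raag u) (\pi_raag v) = \pi_raag (u ++ v).
Proof. by apply/raag_piP/raag_cat; apply: raag_reprP. Qed.

Lemma raag_inv_pi u : raag_inv (\pi_raag u) = \pi_raag (word_inv u).
Proof. by apply/raag_piP/word_inv_cong/raag_reprP. Qed.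

Lemma raag_mulA : associative raag_mul.
Proof.
elim/quotW => u; elim/quotW => v; elim/quotW => w.
by rewrite (raag_mul_pi u v) (raag_mul_pi v w) !raag_mul_pi catA.
Qed.

Lemma raag_mul1 : left_id raag_one raag_mul.
Proof. by move=> x; rewrite -[x]reprK raag_mul_pi. Qed.

Lemma raag_mulr1 : right_id raag_one raag_mul.
Proof. by move=> x; rewrite -[x]reprK raag_mul_pi cats0. Qed.

Lemma raag_mulVx : left_inverse raag_one raag_inv raag_mul.
Proof.
move=> x; rewrite -[x]reprK raag_inv_pi raag_mul_pi; apply/raag_piP.
by rewrite -{2}[repr x]word_invK; apply: word_mulV.
Qed.

Lemma raag_mulxV : right_inverse raag_one raag_inv raag_mul.
Proof.
by move=> x; rewrite -[x]reprK raag_inv_pi raag_mul_pi; apply/raag_piP/word_mulV.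
Qed.

HB.instance Definition _ := isGroup.Build raag
  raag_mulA raag_mul1 raag_mulr1 raag_mulVx raag_mulxV.

Definition raag_gen (v : G) : raag := \pi_raag [:: (v, false)].

End RAAG.

Section GroupNotions.
Variable gT : groupType.
Implicit Types (x y z : gT) (A : set gT).

Definition centralizer x : set gT := [set y | commute x y].

Definition center A : set gT :=
  [set y | A y /\ forall z, A z -> commute y z].

Definition abelian_set A : Prop :=
  forall y z, A y -> A z -> commute y z.

Definition cyclic_subgroup x : set gT :=
  [set y | exists n : nat, y = x ^+ n \/ y = x ^- n].

Definition conjugate x y : Prop := exists g, x = y ^ g.

End GroupNotions.

(* Main.v *)
(* If x is not conjugate into A(V - v), it acts hyperbolically on the Bass-Serre
   tree of the splitting of A over A(lk v) as an HNN extension with stable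
   letter v.  Elements commuting with x eventually shift a ray of its axis, so
   a commutator of two of them fixes an edge and is conjugate into A(lk v).
   Now let A(S) be a parabolic subgroup of minimal rank meeting the conjugacy
   class of x.  The above applies to every v in S.  If S had two vertices v, w,
   commutators of elements of C(x) would be conjugate into A(lk v :&: lk w),
   which has rank at most one in an ear other than C_4; retracting onto it kills
   commutators, so C(x) would be abelian.  Hence x is conjugate to a power of a
   vertex v, and retracting onto A(lk v) shows that this conjugate of v is
   central in C(x) = C(v).

   The tree is the Cayley tree of the kernel of A -> A(V - v), which is free on
   the cosets A(V - v) / A(lk v) (through k |-> k v k^-1): A(V - v) permutes
   the letters of reduced words and v acts by multiplication. *)
Require Import Defs.
From mathcomp Require Import all_boot boolp classical_sets.
From HB Require Import structures.
From mathcomp Require Import generic_quotient zify.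

Set Implicit Arguments.
Unset Strict Implicit.
Unset Printing Implicit Defensive.

Local Open Scope set_scope.
Local Open Scope group_scope.

(** * Free groups: multiplication of reduced words *)

Section ReducedWords.
Variable X : eqType.
Implicit Types (s t : X * bool) (p q r w : seq (X * bool)).

Definition flip s : X * bool := (s.1, ~~ s.2).

Lemma flipK : involutive flip.
Proof. by case=> x e; rewrite /flip /= negbK. Qed.

Definition reduced : pred (seq (X * bool)) :=
  sorted (fun s t => t != flip s).

Definition cons_red s w : seq (X * bool) :=
  if w is t :: w' then if t == flip s then w' else s :: w else [:: s].

Definition redmul p q : seq (X * bool) := foldr cons_red q p.

Lemma reduced_cons s w :
  reduced (s :: w) = (if w is t :: _ then t != flip s else true) && reduced w.
Proof. by case: w. Qed.

Lemma reduced_catl p q : reduced (p ++ q) -> reduced p.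
Proof. by rewrite /reduced => /(take_sorted (size p)); rewrite take_size_cat. Qed.

Lemma reduced_catr p q : reduced (p ++ q) -> reduced q.
Proof. by rewrite /reduced => /(drop_sorted (size p)); rewrite drop_size_cat. Qed.

Lemma cons_red_id s w : reduced (s :: w) -> cons_red s w = s :: w.
Proof. by case: w => [|t w] //= /andP[/negPf ->]. Qed.

Lemma cons_red_reduced s w : reduced w -> reduced (cons_red s w).
Proof.
case: w => [|t w] // rw; rewrite /cons_red; case: eqP => [_ | /eqP ne].
  by have /(@reduced_catr [:: t]) := rw.
by rewrite reduced_cons ne.
Qed.

Lemma cons_redK s w : reduced w -> cons_red (flip s) (cons_red s w) = w.
Proof.
case: w => [|t w] rw /=; first by rewrite flipK eqxx.
case: eqP rw => [-> | /eqP ne] rw; first by rewrite cons_red_id.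
by rewrite /= flipK eqxx.
Qed.

Lemma redmul_reduced p q : reduced q -> reduced (redmul p q).
Proof. by move=> rq; elim: p => //= s p; apply: cons_red_reduced. Qed.

Lemma redmul_cons_red s p q : reduced p -> reduced q ->
  redmul (cons_red s p) q = cons_red s (redmul p q).
Proof.
case: p => [|t p] //= rp rq; case: eqP => [-> | _] //.
by rewrite -{1}[s]flipK cons_redK // redmul_reduced.
Qed.

Lemma redmul_rcons p s q : redmul (rcons p s) q = redmul p (cons_red s q).
Proof. by rewrite /redmul foldr_rcons. Qed.

Lemma redmul_cat p q : reduced (p ++ q) -> redmul p q = p ++ q.
Proof.
elim: p => // s p IHp rpq; rewrite /= IHp ?cons_red_id //.
by have /(@reduced_catr [:: s]) := rpq.
Qed.

Lemma redmulw0 p : reduced p -> redmul p [::] = p.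
Proof. by move=> rp; rewrite redmul_cat cats0. Qed.

Lemma size_cons_red s w : size w <= (size (cons_red s w)).+1.
Proof. by case: w => //= t w; case: ifP => //= _; lia. Qed.

Lemma size_redmul p q : size q <= size p + size (redmul p q).
Proof.
elim: p => //= s p IHp.
by have := size_cons_red s (redmul p q); lia.
Qed.

(** Each letter of [p] cancels at most one letter of [q], so a letter of [q] always survives to
    shield [r]. *)
Lemma redmul_catr p q r : size p < size q -> redmul p (q ++ r) = redmul p q ++ r.
Proof.
elim: p => //= s p IHp lt; rewrite IHp; last by lia.
have := size_redmul p q; case: (redmul p q) => [|t w] /=; first by lia.
by case: ifP.
Qed.

(** [j] counts the cancelled pairs. Once cancellation stops inside [p] it cannot resume, because [p]
    is reduced. *)
Lemma redmul_split p q : reduced p -> reduced q ->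
  exists j, [/\ j <= size p, j <= size q &
    redmul p q = take (size p - j) p ++ drop j q].
Proof.
elim: p => [|s p IHp] rp rq; first by exists 0; rewrite drop0.
have rp' : reduced p by have /(@reduced_catr [:: s]) := rp.
have [j [jp jq /= ->]] := IHp rp' rq.
have [lt | ge] := ltnP j (size p).
  exists j; split=> //; first by rewrite /=; lia.
  rewrite subSn // take_cons /=.
  case: p rp {IHp rp'} jp lt => //= t p /andP[/negPf ne _] _ lt.
  by rewrite subSn //= ne.
(* All of [p] has cancelled, so [s] meets what is left of [q] and may cancel one more letter. *)
have -> : j = size p by lia.
rewrite subnn take0 /=.
have ple : size p <= size q by lia.
have keep : cons_red s (drop (size p) q) = s :: drop (size p) q ->
    exists j0, [/\ j0 <= (size p).+1, j0 <= size q &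
    cons_red s (drop (size p) q) =
      take ((size p).+1 - j0) (s :: p) ++ drop j0 q].
  by move=> ->; exists (size p); rewrite subSnn /= take0.
case Eq: (drop (size p) q) keep => [|t r] /=; first exact.
case: eqP => [_ _ | _]; last exact.
have lt : size p < size q.
  by have := congr1 size Eq; rewrite size_drop /=; lia.
exists (size p).+1; split=> //; rewrite subnn /=.
by rewrite -addn1 addnC -drop_drop Eq /= drop0.
Qed.

End ReducedWords.

(** * Retractions onto parabolic subgroups, and exponent sums *)

Section RaagBasics.
Variable G : sgraph.
Local Notation A := (raag G).
Local Notation cls u := (\pi_(raag G)%qT u : A).
Implicit Types (g h c y z : A) (u : word G) (s : G * bool) (S T : {set G}).

Definition letter s : A := cls [:: s].

Lemma cls_cat u u' : cls (u ++ u') = cls u * cls u'.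
Proof. exact/esym/raag_mul_pi. Qed.

Lemma cls_cons s u : cls (s :: u) = letter s * cls u.
Proof. exact: (cls_cat [:: s]). Qed.

Lemma cls_nil : cls [::] = 1.
Proof. by []. Qed.

Lemma raag_ind (P : A -> Prop) :
  P 1 -> (forall s g, P g -> P (letter s * g)) -> forall g, P g.
Proof.
move=> P1 Ps; elim/quotW => u; elim: u => [|s u IHu] //.
by rewrite cls_cons; apply: Ps.
Qed.

Lemma letterV a b : letter (a, ~~ b) = (letter (a, b))^-1.
Proof.
apply/esym/mulg1_eq; rewrite -cls_cons; apply/raag_piP/raag_cancel.
Qed.

Lemma letter_commute a a' b b' :
  adj a a' -> commute (letter (a, b)) (letter (a', b')).
Proof.
move=> aa'; have com : commute (letter (a, false)) (letter (a', false)).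
  by rewrite /commute -!cls_cons; apply/raag_piP/raag_comm.
have com1 : commute (letter (a, false)) (letter (a', b')).
  by case: b' => //; rewrite -[true]/(~~ false) letterV; apply: commuteV.
case: b => //; rewrite -[true]/(~~ false) letterV.
exact/commute_sym/commuteV/commute_sym.
Qed.

Definition retract S g : A := cls [seq s <- repr g | s.1 \in S].

(** Deleting the letters outside [S] turns each defining relation into itself or into a trivial
    one. *)
Lemma raag_cong_filter S u u' : raag_cong u u' ->
  raag_cong [seq s <- u | s.1 \in S] [seq s <- u' | s.1 \in S].
Proof.
elim=> {u u'} [u|u u' _ /raag_sym|u' u w _ + _|u u' w w' _ IHu _ IHw|a b|
  a b ab] //=.
- exact: raag_refl.
- exact: raag_trans.
- by rewrite !filter_cat; apply: raag_cat.
- by case: (a \in S); [apply: raag_cancel | apply: raag_refl].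
by case: (a \in S) (b \in S) => -[]; try exact: raag_refl; apply: raag_comm.
Qed.

Lemma retract_cls S u : retract S (cls u) = cls [seq s <- u | s.1 \in S].
Proof.
exact/raag_piP/raag_cong_filter/raag_reprP.
Qed.

Lemma retract_morphism S : monoid_morphism (retract S).
Proof.
split=> [|g h]; first by rewrite -cls_nil retract_cls.
by rewrite -[g]reprK -[h]reprK -cls_cat !retract_cls filter_cat cls_cat.
Qed.
HB.instance Definition _ S :=
  isUMagmaMorphism.Build A A (retract S) (retract_morphism S).

Lemma retract_letter S s :
  retract S (letter s) = if s.1 \in S then letter s else 1.
Proof. by rewrite retract_cls /=; case: ifP. Qed.

Lemma retract_comp S T g : retract S (retract T g) = retract (S :&: T) g.
Proof.
rewrite -[g]reprK (retract_cls T) (retract_cls S) retract_cls -filter_predI.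
by congr (cls _); apply: eq_filter => s; rewrite /= inE.
Qed.

(** A(S) is described as the fixed points of its retraction, so that membership is an equation to
    rewrite with. *)
Definition parabolic S g : Prop := retract S g = g.

Lemma parabolic_retract S g : parabolic S (retract S g).
Proof. by rewrite /parabolic retract_comp finset.setIid. Qed.

Lemma parabolic_letter S s : s.1 \in S -> parabolic S (letter s).
Proof. by rewrite /parabolic retract_letter => ->. Qed.

Lemma parabolic_setT g : parabolic [set: G] g.
Proof.
rewrite /parabolic -[g]reprK retract_cls; congr (cls _).
by apply/all_filterP/allP => s; rewrite inE.
Qed.

Lemma parabolic_commute S :
  {in S &, forall a b, adj a b || (a == b)} ->
  forall y z, parabolic S y -> parabolic S z -> commute y z.
Proof.
move=> cS y z <- <-; move: y z.
have key s z : s.1 \in S -> commute (letter s) (retract S z).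
  case: s => a b /= aS; elim/raag_ind: z => [|[a' b'] z IHz].
    by rewrite gmulf1; apply: commute1.
  rewrite gmulfM /= retract_letter /=.
  case: ifP => [a'S|_]; last by rewrite mul1g.
  apply: commuteM => //.
  have /orP[/letter_commute // | /eqP <-] := cS a a' aS a'S.
  case: b b' {IHz} => -[]; try exact: commute_refl.
    rewrite -[true]/(~~ false) letterV; apply/commute_sym/commuteV.
    exact: commute_refl.
  by rewrite -[true]/(~~ false) letterV; apply/commuteV/commute_refl.
move=> y z; elim/raag_ind: y => [|s y IHy].
  by rewrite gmulf1; apply/commute_sym/commute1.
rewrite gmulfM /= retract_letter; case: ifP => [sS|_]; last by rewrite mul1g.
by apply/commute_sym/commuteM; apply: commute_sym => //; apply: key.
Qed.

Definition conj_into S g : Prop := exists h, parabolic S (g ^ h).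

Lemma conj_into_conj S g h : conj_into S (g ^ h) -> conj_into S g.
Proof. by case=> k; rewrite -conjgM; exists (h * k). Qed.

(* If g is conjugate to p in A(S) and to q in A(T), retracting to A(S) shows
   that p is conjugate to the retract of q, which lies in A(S :&: T). *)
Lemma conj_intoI S T g :
  conj_into S g -> conj_into T g -> conj_into (S :&: T) g.
Proof.
case=> h gS [k gT]; exists (h * (retract S (k^-1 * h))^-1).
have -> : g ^ (h * (retract S (k^-1 * h))^-1) = retract S (g ^ k).
  apply: (conjg_inj (retract S (k^-1 * h))).
  by rewrite conjgM conjgKV -gmulfJ -conjgM mulVKg /= gS.
by rewrite -gT retract_comp; apply: parabolic_retract.
Qed.

Lemma conj_into_retract1 S g : conj_into S g -> retract S g = 1 -> g = 1.
Proof.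
case=> h gS g1; apply/eqP; rewrite -(conjg_eq1 _ h); apply/eqP.
by rewrite -gS gmulfJ /= g1 conj1g.
Qed.

(** On at most one generator A(S) is abelian, so the retraction kills commutators, yet it kills no
    nontrivial conjugate of an element of A(S). *)
Lemma conj_into_comm1 S y z :
  #|S| <= 1 -> conj_into S [~ y, z] -> [~ y, z] = 1.
Proof.
move=> /card_le1_eqP S1 /conj_into_retract1; apply.
rewrite gmulfR; apply/eqP/commgP.
apply: (@parabolic_commute S); try exact: parabolic_retract.
by move=> a b aS bS; rewrite (S1 a b) // eqxx orbT.
Qed.

(** Equality of the exponent sums of [a], with the negative counts moved across to avoid truncated
    subtraction. *)
Definition exponents_match a u u' : Prop :=
  (count_mem (a, false) u + count_mem (a, true) u' =
   count_mem (a, false) u' + count_mem (a, true) u)%N.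

Lemma raag_cong_exponents a u u' : raag_cong u u' -> exponents_match a u u'.
Proof.
rewrite /exponents_match.
elim=> {u u'} [|u u' _|u' u w _ + _|u u' w w' _ + _|b []|b c _] //=;
  rewrite ?count_cat /= ?xpair_eqE /=; try lia.
all: by rewrite !andbT !andbF ?addn0 ?add0n //; lia.
Qed.

Lemma expg_gen (a : G) n : raag_gen a ^+ n = cls (nseq n (a, false)).
Proof. by elim: n => [|n IHn] //; rewrite expgS IHn /= cls_cons. Qed.

Lemma expVg_gen (a : G) n : raag_gen a ^- n = cls (nseq n (a, true)).
Proof.
rewrite -expVgn; elim: n => [|n IHn] //.
by rewrite expgS IHn /= cls_cons -[true]/(~~ false) letterV.
Qed.

Lemma expg_gen_inj (a : G) n : raag_gen a ^+ n = raag_gen a -> n = 1%N.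
Proof.
rewrite expg_gen => /raag_piP/(raag_cong_exponents a).
by rewrite /exponents_match !count_nseq /= !xpair_eqE eqxx /=; lia.
Qed.

Lemma expVg_gen_neq (a : G) n : raag_gen a ^- n <> raag_gen a.
Proof.
rewrite expVg_gen => /raag_piP/(raag_cong_exponents a).
by rewrite /exponents_match !count_nseq /= !xpair_eqE eqxx /=; lia.
Qed.

Lemma parabolic1P (a : G) g : parabolic [set a] g ->
  exists n, g = raag_gen a ^+ n \/ g = raag_gen a ^- n.
Proof.
move=> <-; elim/raag_ind: g => [|[b e] g [n IHg]].
  by exists 0; left; rewrite gmulf1.
rewrite gmulfM /= retract_letter inE /=; case: eqP => [->|_]; last first.
  by exists n; rewrite mul1g.
case: e IHg => -[] ->.
- case: n => [|n]; first by exists 1%N; right; rewrite mulg1 -letterV.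
  by exists n; left; rewrite (letterV a false) expgS mulKg.
- exists n.+1; right; rewrite (letterV a false) expgSr invgM //.
- by exists n.+1; left; rewrite expgS.
- case: n => [|n]; first by exists 1%N; left; rewrite invg1 mulg1.
  by exists n; right; rewrite expgSr invgM mulVKg.
Qed.

End RaagBasics.

(** * The action on the Bass-Serre tree of the HNN splitting at [v] *)

Section TreeAction.
Variables (G : sgraph) (v : G).
Local Notation A := (raag G).
Local Notation cls u := (\pi_(raag G)%qT u : A).
(* A vertex of the tree is a reduced word in free generators indexed by the
   cosets k A(lk v), k in A(V - v).  Such a coset is recorded together with the
   conjugate k v k^-1: the former gives edge stabilizers, the latter evaluates
   a vertex back to an element of A. *)
Local Notation L := ((A * set A) * bool)%type.
Implicit Types (g h : A) (s : G * bool) (t : L) (w : seq L).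

Definition link : {set G} := [set a | adj v a].
Local Notation rho := (retract [set~ v]).

(** Conjugation on the evaluated element and left translation on the coset: the preimage under g^-1
    is gC. *)
Definition translate g t : L :=
  ((g * t.1.1 * g^-1, (fun z => t.1.2 (g^-1 * z))), t.2).

Definition base_edge e : L := ((raag_gen v, parabolic link), e).

Definition letter_act s w : seq L :=
  if s.1 == v then cons_red (base_edge s.2) w
  else map (translate (letter s)) w.

(** The word chosen by [repr] is immaterial on reduced [w], by [raag_cong_act]. *)
Definition act g w : seq L := foldr letter_act w (repr g).

Lemma translate1 : translate 1 =1 id.
Proof.
case=> [[z C] e]; rewrite /translate /= mul1g invg1 mulg1.
by congr (_, _, _); apply/funext => y; rewrite mul1g.
Qed.

Lemma translateM g h : translate (g * h) =1 translate g \o translate h.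
Proof.
case=> [[z C] e]; rewrite /translate /=.
congr (_, _, _); first by rewrite invgM !mulgA.
by apply/funext => y; rewrite invgM mulgA.
Qed.

Lemma translateK g : cancel (translate g) (translate g^-1).
Proof. by move=> t; rewrite -[LHS]translateM mulVg translate1. Qed.

Lemma map_translate1 w : map (translate 1) w = w.
Proof. by rewrite (eq_map translate1) map_id. Qed.

Lemma map_translateM g h w :
  map (translate (g * h)) w = map (translate g) (map (translate h) w).
Proof. by rewrite (eq_map (translateM g h)) map_comp. Qed.

Lemma translate_flip g t : translate g (flip t) = flip (translate g t).
Proof. by []. Qed.

Lemma translate_eq_flip g t t' :
  (translate g t' == flip (translate g t)) = (t' == flip t).
Proof. by rewrite -translate_flip (inj_eq (can_inj (translateK g))). Qed.

Lemma map_translate_cons_red g t w :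
  map (translate g) (cons_red t w) =
  cons_red (translate g t) (map (translate g) w).
Proof. by case: w => //= t' w; rewrite translate_eq_flip; case: ifP. Qed.

Lemma map_translate_redmul g w w' :
  map (translate g) (redmul w w') =
  redmul (map (translate g) w) (map (translate g) w').
Proof. by elim: w => //= t w IHw; rewrite map_translate_cons_red IHw. Qed.

Lemma map_translate_reduced g w :
  reduced (map (translate g) w) = reduced w.
Proof. by apply: mono_sorted => t t'; rewrite translate_eq_flip. Qed.

(** A(lk v) commutes with [v] and preserves itself as a coset. This makes the relations between [v]
    and its neighbors hold in the action. *)
Lemma translate_base_link s e :
  s.1 \in link -> translate (letter s) (base_edge e) = base_edge e.
Proof.
case: s => a b aL; congr (_, _, _) => /=.
  have va : adj v a by rewrite inE in aL.
  by rewrite -(letter_commute false b va) mulgK.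
apply/funext => z; apply/propext; rewrite /parabolic -letterV gmulfM /=.
by rewrite retract_letter aL; split=> [/mulgI | ->].
Qed.

Lemma letter_act_reduced s w : reduced w -> reduced (letter_act s w).
Proof.
move=> rw; rewrite /letter_act; case: eqP => _; first exact: cons_red_reduced.
by rewrite map_translate_reduced.
Qed.

Lemma word_act_reduced (u : word G) w :
  reduced w -> reduced (foldr letter_act w u).
Proof. by move=> rw; elim: u => //= s u; apply: letter_act_reduced. Qed.

Lemma raag_cong_act (u u' : word G) w : raag_cong u u' -> reduced w ->
  foldr letter_act w u = foldr letter_act w u'.
Proof.
move=> uu'; elim: uu' w => {u u'} [//|u u' _ IH|u' u u'' _ IH _ IH'|
  u u' u1 u1' _ IH _ IH1|a b|a b ab] w rw.
- by rewrite IH.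
- by rewrite IH ?IH'.
- by rewrite !foldr_cat IH1 // IH // word_act_reduced.
- rewrite /= /letter_act /=; case: eqP => _.
    by have := cons_redK (flip (base_edge b)) rw; rewrite flipK.
  by rewrite -map_translateM letterV mulgV map_translate1.
rewrite /= /letter_act /=; have := adj_irr a.
case: eqP ab => [->|_] ab; case: eqP ab => [->|_] ab irr.
- by rewrite ab in irr.
- by rewrite map_translate_cons_red translate_base_link // inE.
- by rewrite map_translate_cons_red translate_base_link // inE adj_sym.
by rewrite -!map_translateM (letter_commute _ _ ab).
Qed.

Lemma act_reduced g w : reduced w -> reduced (act g w).
Proof. exact: word_act_reduced. Qed.

Lemma act_cls (u : word G) w :
  reduced w -> act (cls u) w = foldr letter_act w u.
Proof. by apply: raag_cong_act; apply: raag_reprP. Qed.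

Lemma act1 w : reduced w -> act 1 w = w.
Proof. exact: (act_cls [::]). Qed.

Lemma actM g h w : reduced w -> act (g * h) w = act g (act h w).
Proof.
elim/quotW: g => u; elim/quotW: h => u' rw.
rewrite -[_ * _]/(cls u * cls u') -cls_cat !act_cls ?foldr_cat //.
exact: word_act_reduced.
Qed.

Lemma act_letter s w : reduced w -> act (letter s) w = letter_act s w.
Proof. by move=> rw; rewrite act_cls. Qed.

Lemma actK g w : reduced w -> act g^-1 (act g w) = w.
Proof. by move=> rw; rewrite -actM // mulVg act1. Qed.

(** The action of a semidirect product: A(V - v) permutes the letters, then the kernel part of [g]
    multiplies on the left. *)
Lemma actE g w : reduced w ->
  act g w = redmul (act g [::]) (map (translate (rho g)) w).
Proof.
move=> rw; elim/raag_ind: g => [|s g IHg].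
  by rewrite gmulf1 map_translate1 !act1.
rewrite !actM // !act_letter ?act_reduced // IHg gmulfM /= retract_letter.
rewrite /letter_act !inE; case: eqP => _ /=.
  by rewrite mul1g redmul_cons_red ?act_reduced ?map_translate_reduced.
by rewrite map_translate_redmul map_translateM.
Qed.

Definition eval_edge t : A := if t.2 then t.1.1^-1 else t.1.1.

Definition eval_vertex w : A := foldr (fun t g => eval_edge t * g) 1 w.

Lemma eval_base e : eval_edge (base_edge e) = letter (v, e).
Proof. by case: e; rewrite // -[true]/(~~ false) letterV. Qed.

Lemma eval_translate g t :
  eval_edge (translate g t) = g * eval_edge t * g^-1.
Proof. by rewrite /eval_edge /=; case: t.2; rewrite // !invgM invgK mulgA. Qed.

Lemma eval_map_translate g w :
  eval_vertex (map (translate g) w) = g * eval_vertex w * g^-1.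
Proof.
elim: w => [|t w IHw] /=; first by rewrite mulg1 mulgV.
by rewrite eval_translate IHw !mulgA mulgVK.
Qed.

Lemma eval_flip t : eval_edge (flip t) = (eval_edge t)^-1.
Proof. by case: t => z [] /=; rewrite /eval_edge /= ?invgK. Qed.

Lemma eval_cons_red t w :
  eval_vertex (cons_red t w) = eval_edge t * eval_vertex w.
Proof.
case: w => //= t' w; case: eqP => [-> | _] //.
by rewrite eval_flip mulVKg.
Qed.

(** The image of the root under [g] records the kernel factor of [g], and [rho g] is the other
    factor. *)
Lemma eval_act g : g = eval_vertex (act g [::]) * rho g.
Proof.
elim/raag_ind: g => [|[a e] g {1}->]; first by rewrite act1 // gmulf1 mulg1.
rewrite actM // act_letter ?act_reduced // gmulfM /= retract_letter.
rewrite /letter_act !inE /=; case: eqP => [->|_] /=.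
  by rewrite eval_cons_red eval_base mul1g mulgA.
by rewrite eval_map_translate !mulgA mulgVK.
Qed.

Lemma act_nil_parabolic g : act g [::] = [::] -> parabolic [set~ v] g.
Proof. by move=> g0; rewrite /parabolic {2}(eval_act g) g0 mul1g. Qed.

(** Such a [g] fixes the coset A(lk v); evaluating both sides at [g] puts [g] in A(lk v). *)
Lemma act_base_link g e : act g [::] = [::] ->
  act g [:: base_edge e] = [:: base_edge e] -> parabolic link g.
Proof.
move=> g0; have gr := act_nil_parabolic g0.
rewrite actE // g0 gr /= => -[_ /(congr1 (@^~ g)) /=].
rewrite mulVg => <-; exact: gmulf1.
Qed.

(** Every edge on the path from the root to its image is a translate of a base edge. Appending a
    letter to a word for [g] moves the endpoint along at most one edge, itself a translate. *)
Lemma act_nil_edge g k : k < size (act g [::]) ->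
  exists h e, act h [::] = take k (act g [::]) /\
    act h [:: base_edge e] = take k.+1 (act g [::]).
Proof.
elim/quotW: g k => u; rewrite -/(cls u).
elim/last_ind: u => [|u [a e] IHu] k; first by rewrite cls_nil act1.
rewrite -cats1 cls_cat actM // (act_letter (a, e)) // /letter_act /=.
case: ifP => _; last exact: IHu.
set p := act (cls u) [::] in IHu *.
have rp : reduced p by apply: act_reduced.
pose t := translate (rho (cls u)) (base_edge e).
have pt : act (cls u) [:: base_edge e] = redmul p [:: t] by rewrite actE.
(* Either the new edge prolongs the path ([j] = 0) or it backtracks over the last one ([j] = 1). *)
have [j [+ +]] := redmul_split rp (isT : reduced [:: t]).
rewrite -pt; case: j => [|[|//]] jp _.
  rewrite subn0 take_size drop0 => ljoin.
  rewrite ljoin size_cat addn1 ltnS leq_eqVlt.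
  case/orP => [/eqP -> | ltk].
    exists (cls u), e; rewrite take_size_cat // take_oversize ?size_cat ?addn1 //.
  have [h [e' [h1 h2]]] := IHu _ ltk; exists h, e'.
  by rewrite h1 h2 !takel_cat //; lia.
rewrite /= cats0 => ->; rewrite size_take_min => ltk.
have /IHu[h [e' [h1 h2]]] : k < size p by lia.
by exists h, e'; rewrite h1 h2 !take_takel //; lia.
Qed.

Lemma reduced_join t t' (w w' : seq L) :
  reduced (t :: w) -> reduced (t' :: w') -> t' != flip (last t w) ->
  reduced ((t :: w) ++ t' :: w').
Proof. by rewrite /reduced /= cat_path => -> /= -> ->. Qed.

(** * Hyperbolic elements whose axis passes through the root *)

Section Hyperbolic.
Variables (x : A) (t0 : L) (w0 : seq L).
Hypothesis x0 : act x [::] = t0 :: w0.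
Hypothesis xmin : forall h, size (act x [::]) <= size (act (x ^ h) [::]).

Let x0_reduced : reduced (t0 :: w0).
Proof. by rewrite -x0 act_reduced. Qed.

(* Otherwise conjugating [x] by the first edge of its path would shorten it;
   edges are never inverted because translations preserve their sign. *)
Let no_cancel : translate (rho x) t0 != flip (last t0 w0).
Proof.
apply/eqP => cancel; case/lastP: w0 x0 x0_reduced cancel => [|w t1] xE xr.
  by move=> /(congr1 snd) /=; case: t0.2.
rewrite last_rcons => cancel.
have [|h [e [h0 h1]]] := @act_nil_edge x 0; first by rewrite xE.
rewrite xE /= take0 in h1.
pose k := h * letter (v, e).
have k0 : act k [::] = [:: t0].
  by rewrite actM // act_letter // /letter_act /= eqxx.
pose w' := map (translate (rho k)^-1) w.
have rtw : reduced (t0 :: w).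
  by move: xr; rewrite -rcons_cons -cats1; apply: reduced_catl.
have rw : reduced w by apply: (@reduced_catr _ [:: t0]).
have rw' : reduced w' by rewrite map_translate_reduced.
have kw' : act k w' = t0 :: w.
  rewrite actE // k0 -map_translateM mulgV map_translate1.
  by rewrite redmul_cat.
have xt0 : act x [:: t0] = t0 :: w.
  rewrite actE // xE -rcons_cons redmul_rcons /= cancel eqxx.
  exact: (redmulw0 rtw).
have : act (x ^ k) [::] = w'.
  by rewrite /conjg actM // actM // k0 xt0 -kw' actK.
move/(congr1 size); have := xmin k; rewrite xE /= size_rcons.
by move=> /[swap] ->; rewrite size_map; lia.
Qed.

Let u n : seq L := act (x ^+ n) [::].

Let u_reduced n : reduced (u n).
Proof. exact: act_reduced. Qed.

(** By [no_cancel], successive translates of the path from the root to its image under [x] join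
    without backtracking. *)
Let u1 n : u n.+1 = (t0 :: w0) ++ map (translate (rho x)) (u n).
Proof.
have uS m : u m.+1 = redmul (t0 :: w0) (map (translate (rho x)) (u m)).
  by rewrite /u expgS actM // actE ?act_reduced // x0.
elim: n => [|n IHn]; first by rewrite uS /u act1 // redmulw0 // cats0.
rewrite uS redmul_cat // [in X in _ ++ X]IHn; apply: reduced_join => //.
by have := u_reduced n.+1; rewrite -(map_translate_reduced (rho x)) IHn.
Qed.

Let size_u n : size (u n) = (n * (size w0).+1)%N.
Proof.
elim: n => [|n IHn]; first by rewrite /u act1.
by rewrite u1 size_cat size_map IHn mulSn.
Qed.

Let u_prefix n m : n <= m -> exists w, u m = u n ++ w.
Proof.
have step i : exists w, u i.+1 = u i ++ w.
  elim: i => [|i [w IHi]]; first by exists (u 1); rewrite /u act1.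
  by exists (map (translate (rho x)) w); rewrite u1 [in LHS]IHi map_cat catA -u1.
move=> /subnK <-; elim: (m - n)%N => [|i [w IHi]].
  by exists [::]; rewrite cats0.
by have [w'] := step (i + n)%N; rewrite IHi -catA; exists (w ++ w').
Qed.

(** The vertices of the half-axis from the root. The power [k] is large enough because each factor
    [x] adds at least one edge. *)
Definition ray k : seq L := take k (act (x ^+ k) [::]).

Let take_u n k : k <= size (u n) -> take k (u n) = ray k.
Proof.
rewrite /ray -/(u k) => kn.
have kk : k <= size (u k) by rewrite size_u mulnS leq_addr.
by have [/u_prefix[w ->] | /ltnW/u_prefix[w ->]] := leqP n k; rewrite takel_cat.
Qed.

Let le_size_u k : k <= size (u k).
Proof. by rewrite size_u mulnS leq_addr. Qed.

Lemma ray_reduced k : reduced (ray k).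
Proof. exact/take_sorted/u_reduced. Qed.

(** Since y x^n = x^n y, the image of [u n] under [y] differs from [u n] only near its end. Far out,
    [y] also sends successive ray edges to successive edges, so it shifts the ray. *)
Lemma commute_shift_ray (y : A) : commute x y ->
  exists a b, forall k, act y (ray (a + k)) = ray (b + k).
Proof.
move=> xy; have [q yq] : exists q, act y [::] = q by eexists.
have rq : reduced q by rewrite -yq act_reduced.
(* Beyond length [size q], cancellation against [q] ends within the first [a] letters, whence
   [ext]. *)
have [a aq] : exists a, a = (size q).+1 by eexists.
have [b br] : exists b, size (act y (ray a)) = b by eexists.
have size_ray k : size (ray k) = k by rewrite size_takel.
(* [n] is so large that the at most [size q] letters lost at the end of [u n] lie beyond position
   [b + k]. *)
exists a, b => k; have [n nlarge] : exists n, a + b + k + size q <= n by eexists.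
have un_large : n <= size (u n) by apply: le_size_u.
pose tau := map (translate (rho y)).
have ext m w : reduced (ray (a + m) ++ w) ->
    act y (ray (a + m) ++ w) = act y (ray (a + m)) ++ tau w.
  move=> rw; rewrite actE // [in RHS]actE ?ray_reduced // map_cat.
  by rewrite yq redmul_catr // size_map size_ray aq leq_addr.
have un m : m <= n -> u n = ray m ++ drop m (u n).
  move=> mn; rewrite -(@take_u n) ?cat_take_drop //.
  exact: leq_trans (le_size_u n).
have sz : size (act y (ray (a + k))) = (b + k)%N.
  have ak : ray (a + k) = ray (a + 0) ++ drop a (ray (a + k)).
    by rewrite addn0 -[LHS](cat_take_drop a) /ray take_takel ?leq_addr // -/(u _)
       take_u // (leq_trans _ (le_size_u _)) ?leq_addr.
  rewrite ak ext -?ak ?ray_reduced // size_cat size_map size_drop size_ray addn0.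
  by rewrite br; lia.
have yu : act y (u n) = redmul (u n) (map (translate (rho (x ^+ n))) q).
  by rewrite -actM // (commuteX n (commute_sym xy)) actM // yq actE.
have [j [jn jq spl]] := redmul_split (u_reduced n)
  (etrans (map_translate_reduced (rho (x ^+ n)) q) rq).
rewrite size_map in jq.
have := congr1 (take (b + k)) yu; rewrite spl.
have bk : b + k <= size (u n) - j.
  by lia.
rewrite takel_cat ?size_takel ?leq_subr // take_takel // take_u; last first.
  exact: leq_trans bk (leq_subr _ _).
rewrite (un (a + k)%N); last by lia.
rewrite ext -?un ?u_reduced //; last by lia.
by rewrite take_size_cat.
Qed.

(** Shifts of a ray commute far out, so the commutator fixes an edge there. That edge is a translate
    of a base edge, whose stabilizer is A(lk v). *)
Lemma commute_conj_link (y z : A) :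
  commute x y -> commute x z -> conj_into link [~ y, z].
Proof.
move=> /commute_shift_ray[a [b yray]] /commute_shift_ray[c [d zray]].
have fix_ray k : act [~ y, z] (ray (a + c + k)) = ray (a + c + k).
  have yz : act (y * z) (ray (a + c + k)) = act (z * y) (ray (a + c + k)).
    rewrite !actM ?ray_reduced //.
    rewrite [in LHS](_ : a + c + k = c + (a + k))%N ?zray; last by lia.
    rewrite (_ : d + (a + k) = a + (d + k))%N ?yray; last by lia.
    rewrite (_ : a + c + k = a + (c + k))%N ?yray; last by lia.
    rewrite (_ : b + (c + k) = c + (b + k))%N ?zray; last by lia.
    by rewrite addnCA.
  (* The commutator is (zy)^-1 (yz). *)
  rewrite commgEl /conjg !mulgA -mulgA -invgM actM ?ray_reduced // yz.
  by rewrite actK ?ray_reduced.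
have [|h [e [h0 h1]]] := @act_nil_edge (x ^+ (a + c).+1) (a + c).
  exact: le_size_u.
rewrite take_u in h0; last exact: leq_trans (le_size_u _).
rewrite -/(ray _) in h1.
exists h; apply: (@act_base_link _ e).
  by rewrite /conjg actM // actM // h0 -[(a + c)%N]addn0 fix_ray addn0 -h0 actK.
by rewrite /conjg actM // actM // h1 -addn1 fix_ray addn1 -h1 actK.
Qed.

End Hyperbolic.

End TreeAction.

(** * Commutators in the centralizer and parabolics of minimal rank *)

Section Hyperbolicity.
Variable G : sgraph.
Local Notation A := (raag G).
Implicit Types (x y z g : A) (v : G) (S : {set G}).

(** A conjugate of [x] moving the root least has a nonempty path, since otherwise it would lie in
    A(V - v); its axis then passes through the root. *)
Lemma not_conj_into_link v x y z : ~ conj_into [set~ v] x ->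
  commute x y -> commute x z -> conj_into (link v) [~ y, z].
Proof.
move=> hyp xy xz; pose P n := `[< exists h, size (act v (x ^ h) [::]) = n >].
have exP : exists n, P n by eexists; apply/asboolP; exists 1.
case: (ex_minnP exP) => n /asboolP[h hn] nmin.
case E : (act v (x ^ h) [::]) => [|t w].
  by case: hyp; exists h; apply: act_nil_parabolic E.
apply: (@conj_into_conj _ _ _ h); rewrite conjRg.
apply: (commute_conj_link E); try by rewrite /commute -!conjMg ?xy ?xz.
by move=> k; rewrite hn; apply/nmin/asboolP; exists (h * k); rewrite conjgM.
Qed.

Lemma parabolic0 x : parabolic finset.set0 x -> x = 1.
Proof.
move=> <-; elim/raag_ind: x => [|s g IHg]; first exact: gmulf1.
by rewrite gmulfM /= IHg retract_letter inE mul1g.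
Qed.

Lemma conj_into_vertex x y z :
    (forall v w, v != w -> #|link v :&: link w| <= 1) ->
    x <> 1 -> commute x y -> commute x z -> ~ commute y z ->
  exists v, conj_into [set v] x.
Proof.
move=> common x1 xy xz yz.
have PT : `[< conj_into [set: G] x >].
  by apply/asboolP; exists 1; apply: parabolic_setT.
case: (@arg_minnP _ [set: G] (fun S => `[< conj_into S x >]) (fun S => #|S|) PT).
move=> S /asboolP Sx Smin.
have hyp v : v \in S -> conj_into (link v) [~ y, z].
  (* Otherwise intersecting with V - v would remove [v] from [S], against minimality. *)
  move=> vS; apply: not_conj_into_link xy xz => vx.
  have /asboolP/Smin := conj_intoI Sx vx; rewrite leqNgt => /negP; apply.
  apply: proper_card; apply/properP; split; first exact: subsetIl.
  by exists v; rewrite // !inE eqxx andbF.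
have [/card_gt1P[v [w [vS wS vw]]]|S1] := ltnP 1 #|S|.
  case: yz; apply/commgP/eqP/(conj_into_comm1 (common v w vw)).
  exact: conj_intoI (hyp v vS) (hyp w wS).
move: S1; rewrite leq_eqVlt ltnS leqn0 => /orP[/cards1P[v Sv]|].
  by exists v; rewrite -Sv.
rewrite cards_eq0 => /eqP S0; case: x1.
case: Sx => h; rewrite S0 => /parabolic0/eqP; rewrite conjg_eq1 => /eqP //.
Qed.

End Hyperbolicity.

(** * Neighbors in paths and cycles *)

Section EarGraphs.

Lemma path_adj_cases n (i j : 'I_n) :
  path_adj i j -> (i.+1 = j :> nat) \/ (j.+1 = i :> nat).
Proof. by case/orP => /eqP; [left | right]. Qed.

Lemma ordS_cases n (i j : 'I_n) : ordS i = j ->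
  (i.+1 = j :> nat) \/ (i.+1 = n :> nat /\ j = 0 :> nat).
Proof.
move=> <- /=; have := ltn_ord i; rewrite leq_eqVlt => /orP[/eqP -> | lt].
  by right; rewrite modnn.
by left; rewrite modn_small.
Qed.

Lemma cycle_adj_cases n (i j : 'I_n) : cycle_adj i j ->
  ((i.+1 = j :> nat) \/ (i.+1 = n :> nat /\ j = 0 :> nat)) \/
  ((j.+1 = i :> nat) \/ (j.+1 = n :> nat /\ i = 0 :> nat)).
Proof.
by case/andP=> _ /orP[] /eqP/ordS_cases; [left | right].
Qed.

Lemma ear_adj_eq (G : sgraph) (v a b c : G) : is_ear G ->
  adj v a -> adj v b -> adj v c -> [|| a == b, b == c | c == a].
Proof.
case=> _ [[n [f /bij_inj finj fadj]] | [n _ [f /bij_inj finj fadj]]].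
  rewrite -!fadj -!(inj_eq finj) -!val_eqE /=.
  by move=> /path_adj_cases ? /path_adj_cases ? /path_adj_cases ?; lia.
rewrite -!fadj -!(inj_eq finj) -!val_eqE /=.
have := (ltn_ord (f v), ltn_ord (f a), ltn_ord (f b), ltn_ord (f c)) => -[[[]]].
move=> ? ? ? ? /cycle_adj_cases ?.
by move=> /cycle_adj_cases ? /cycle_adj_cases ?; lia.
Qed.

(** Two vertices with two common neighbors span a 4-cycle, which no path contains and a cycle
    contains only for [n] = 4. On indices this is linear arithmetic. *)
Lemma ear_common_neighbor (G : sgraph) (v w a b : G) :
  is_ear G -> ~ graph_iso G (cycle_graph 4) ->
  adj v a -> adj v b -> adj w a -> adj w b -> (v == w) || (a == b).
Proof.
case=> _ [[n [f /bij_inj finj fadj]] _ | [n n3 [f fbij fadj]] nC4].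
  rewrite -!fadj -!(inj_eq finj) -!val_eqE /=.
  move=> /path_adj_cases ? /path_adj_cases ?.
  by move=> /path_adj_cases ? /path_adj_cases ?; lia.
have n4 : n != 4.
  by apply/eqP => n4; case: nC4; move: f fbij fadj; rewrite n4 => f; exists f.
rewrite -!fadj -!(inj_eq (bij_inj fbij)) -!val_eqE /=.
move: (f v) (f w) (f a) (f b) => i j k l.
have := (ltn_ord i, ltn_ord j, ltn_ord k, ltn_ord l) => -[[[]]].
move=> ? ? ? ? /cycle_adj_cases ? /cycle_adj_cases ?.
by move=> /cycle_adj_cases ? /cycle_adj_cases ?; lia.
Qed.

Lemma ear_degree (G : sgraph) (v : G) : is_ear G -> #|link v| <= 2.
Proof.
move=> ear; rewrite leqNgt; apply/negP => /card_gt2P[a [b [c [[]]]]].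
rewrite !inE => va vb vc [ab bc ca].
by have := ear_adj_eq ear va vb vc; rewrite (negPf ab) (negPf bc) (negPf ca).
Qed.

Lemma ear_card_linkI (G : sgraph) (v w : G) :
  is_ear G -> ~ graph_iso G (cycle_graph 4) ->
  v != w -> #|link v :&: link w| <= 1.
Proof.
move=> ear nC4 vw; rewrite leqNgt; apply/negP => /card_gt1P[a [b []]].
rewrite !inE => /andP[va wa] /andP[vb wb] ab.
have := ear_common_neighbor ear nC4 va vb wa wb.
by rewrite (negPf vw) (negPf ab).
Qed.

End EarGraphs.

Theorem lemma2p5 (G : sgraph) (hear : is_ear G)
    (hC4 : ~ graph_iso G (cycle_graph 4))
    (x : raag G) (hx1 : x <> 1)
    (hnab : ~ abelian_set (centralizer x))
    (hgen : center (centralizer x) = cyclic_subgroup x) :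
  exists v : G, degree v = 2 /\
    (conjugate x (raag_gen v) \/ conjugate x (raag_gen v)^-1).
Proof.
have [y [z [xy xz yz]]] :
    exists y z, [/\ commute x y, commute x z & ~ commute y z].
  apply: contrapT => no; apply: hnab => y z xy xz; apply: contrapT => yz.
  by apply: no; exists y, z.
have [v [h xv]] : exists v, conj_into [set v] x.
  by apply: conj_into_vertex hx1 xy xz yz => v w; apply: ear_card_linkI.
(* Being conjugate into both A(v) and A(V - v) would put [x] in the trivial parabolic. *)
have hyp : ~ conj_into [set~ v] x.
  move=> xv'; apply: hx1.
  have [k] := conj_intoI (ex_intro _ h xv) xv'; rewrite finset.setICr.
  by move/parabolic0/eqP; rewrite conjg_eq1 => /eqP.
have link_hyp := not_conj_into_link hyp.
exists v; split.
  rewrite /degree -cardsE -/(link v); apply/eqP; rewrite eqn_leq ear_degree //=.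
  (* A link of at most one vertex would force [y] and [z] to commute. *)
  rewrite ltnNge; apply/negP => le1; apply/yz/commgP/eqP.
  exact: conj_into_comm1 le1 (link_hyp _ _ xy xz).
have [b bh] : exists b, b ^ h = raag_gen v.
  by exists (raag_gen v ^ h^-1); rewrite conjgKV.
have xb : commute x b.
  apply: (@conjg_inj _ h); rewrite !conjMg bh.
  apply: (@parabolic_commute _ [set v]) => //; last first.
    by apply: parabolic_letter; rewrite inE.
  by move=> a c; rewrite !inE => /eqP -> /eqP ->; rewrite eqxx orbT.
have : center (centralizer x) b.
  (* The commutator is conjugate into A(lk v), but the retraction there kills [v], hence [b] and the
     commutator. *)
  split=> // w xw; apply/commgP/eqP.
  apply: (conj_into_retract1 (link_hyp _ _ xb xw)).
  have vlk : retract (link v) (raag_gen v) = 1.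
    by rewrite retract_letter inE adj_irr.
  have blk : retract (link v) b = 1.
    by rewrite -(conjgK h b) bh gmulfJ /= vlk conj1g.
  by rewrite gmulfR /= blk comm1g.
rewrite hgen => -[n] bx.
have {bx} : raag_gen v = (x ^ h) ^+ n \/ raag_gen v = (x ^ h) ^- n.
  by case: bx => bx; [left | right];
    rewrite -conjXg -?conjVg -bx bh.
have conj_of w : x ^ h = w -> conjugate x w.
  by move=> <-; exists h^-1; rewrite conjgK.
(* Now x^h is a power of [v] and [v] a power of x^h; comparing exponent sums forces m n = 1, and the
   sign of [xE] decides between [v] and its inverse. *)
have [m [xE | xE]] := parabolic1P xv; rewrite xE ?expVgn ?invgK -!expgnA.
  case=> /esym; last by move/expVg_gen_neq.
  move/expg_gen_inj/eqP; rewrite muln_eq1 => /andP[/eqP m1 _].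
  by left; apply: conj_of; rewrite xE m1.
case=> /esym; first by move/expVg_gen_neq.
move/expg_gen_inj/eqP; rewrite muln_eq1 => /andP[/eqP m1 _].
by right; apply: conj_of; rewrite xE m1.
Qed.
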